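(* There exists an infinite measure preserving, recurrent, and ergodic $\mathbb Z^2$ action $(X,\mu,\{T^{\vec n}\}_{\vec n\in\mathbb Z^2})$ on a $\sigma$-finite Lebesgue space with the property that its set of recurrent directions is empty: $\mathcal R_T=\emptyset$.
   Context: Infinite measure preserving means the maps $T^{\vec n}$ are invertible, measurable and $\mu$-preserving, with $\mu(X)=\infty$. The $\mathbb Z^2$ action is recurrent if for every measurable set $A$ with $\mu(A)>0$ there exists $\vec n\in\mathbb Z^2$, $\vec n\neq\vec 0$, such that $\mu(A\cap T^{\vec n}A)>0$. A direction is an angle $\theta\in[0,\pi)$. For $\epsilon>0$ the $\epsilon$-tunnel of $\theta$ is $\bigcup_{t\in\mathbb R}B_\epsilon(t(\cos\theta,\sin\theta))$, where $B_\epsilon(\vec x)$ is the $\epsilon$-ball around $\vec x\in\mathbb R^2$. A direction $\theta$ is recurrent for $T$ if for all $\epsilon>0$ and all measurable sets $A$ with $\mu(A)>0$ there is a non-zero vector $\vec n\in\mathbb Z^2$ in the $\epsilon$-tunnel of $\theta$ such that $\mu(A\cap T^{\vec n}A)>0$. $\mathcal R_T\subset[0,\pi)$ denotes the set of recurrent directions. *)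

(* Defs.v *)
From HB Require Import structures.
From mathcomp Require Import all_boot all_order all_algebra.
From mathcomp Require Import all_classical all_reals all_analysis.
Set Implicit Arguments.
Unset Strict Implicit.
Unset Printing Implicit Defensive.
Import Order.TTheory GRing.Theory Num.Theory.
Import numFieldNormedType.Exports.

Local Open Scope classical_set_scope.
Local Open Scope ring_scope.

(* The condition on all subsets A of D0 says that phi and its inverse
   E0 -> D0 are both measurable and measure preserving. *)
Definition iso_mod0 (R : realType) (d d' : measure_display)
    (X : measurableType d) (Y : measurableType d')
    (mu : {measure set X -> \bar R}) (D : set X)
    (nu : {measure set Y -> \bar R}) (E : set Y) : Prop :=
  exists (D0 : set X) (E0 : set Y) (phi : X -> Y),
    [/\ [/\ measurable D0, D0 `<=` D & mu.-negligible (D `\` D0)],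
        [/\ measurable E0, E0 `<=` E & nu.-negligible (E `\` E0)],
        set_bij D0 E0 phi &
        forall A : set X, A `<=` D0 ->
          (measurable A <-> measurable (phi @` A)) /\
          (measurable A -> mu A = nu (phi @` A))].

(* Complete and isomorphic mod 0 to a (bounded or unbounded) interval with the
   Lebesgue sigma-algebra and Lebesgue measure, together with at most
   countably many atoms. *)
Definition lebesgue_space (R : realType) (d : measure_display)
    (X : measurableType d) (mu : {measure set X -> \bar R}) : Prop :=
  measure_is_complete mu /\
  exists (atoms : set X) (I : interval R),
    [/\ countable atoms,
        forall a, atoms a -> measurable [set a] /\ (0 < mu [set a])%E &
        iso_mod0 mu (~` atoms) (@completed_lebesgue_measure R) [set` I]].

(* Invertibility of each T n follows from the two group laws. *)
Definition measure_preserving_action (R : realType) (d : measure_display)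
    (X : measurableType d) (mu : {measure set X -> \bar R})
    (T : int * int -> X -> X) : Prop :=
  [/\ T 0 = id,
      forall m n, T (m + n) = T m \o T n,
      forall n, measurable_fun setT (T n) &
      forall n (A : set X), measurable A -> mu (T n @^-1` A) = mu A].

Definition ergodic_action (R : realType) (d : measure_display)
    (X : measurableType d) (mu : {measure set X -> \bar R})
    (T : int * int -> X -> X) : Prop :=
  forall A : set X, measurable A -> (forall n, T n @` A = A) ->
    mu A = 0%E \/ mu (~` A) = 0%E.

Definition recurrent_action (R : realType) (d : measure_display)
    (X : measurableType d) (mu : {measure set X -> \bar R})
    (T : int * int -> X -> X) : Prop :=
  forall A : set X, measurable A -> (0 < mu A)%E ->
    exists2 n : int * int, n != 0 & (0 < mu (A `&` T n @` A))%E.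

(* The library's [ball] on [R * R] is the one of the sup norm. *)
Definition euclidean_ball (R : realType) (x : R * R) (eps : R) : set (R * R) :=
  [set y | Num.sqrt ((y.1 - x.1) ^+ 2 + (y.2 - x.2) ^+ 2) < eps].

Definition tunnel (R : realType) (eps theta : R) : set (R * R) :=
  \bigcup_(t in [set: R]) euclidean_ball (t * cos theta, t * sin theta) eps.

Definition recurrent_direction (R : realType) (d : measure_display)
    (X : measurableType d) (mu : {measure set X -> \bar R})
    (T : int * int -> X -> X) (theta : R) : Prop :=
  forall (eps : R) (A : set X), 0 < eps -> measurable A -> (0 < mu A)%E ->
    exists n : int * int,
      [/\ n != 0, tunnel eps theta (n.1%:~R, n.2%:~R) &
          (0 < mu (A `&` T n @` A))%E].

Definition recurrent_directions (R : realType) (d : measure_display)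
    (X : measurableType d) (mu : {measure set X -> \bar R})
    (T : int * int -> X -> X) : set R :=
  [set theta | 0 <= theta < pi /\ recurrent_direction mu T theta].

(* Main.v *)
(* Take X = R with the completed Lebesgue measure.  The second generator is
   the unit translation; the first one is the dyadic odometer on binary
   expansions of fractional parts, except that when it turns 1^k 0 into 0^k 1
   it also lowers the integer part, by c_k = 4^k - \sum_(j < k) 4^j (and it
   fixes the rationals, a null set).  If d_j(x)
   denotes the j-th binary digit of x, then moving by (n, m) increases
   \sum_j 2^j d_j by n and floor x + \sum_j 4^j d_j by m (both sums formal, only
   differences along an orbit being finite).

   No direction is recurrent: a return (n, m) to [0, 2^-N[ has the form
   (\sum_j 2^j e_j, \sum_j 4^j e_j) with e_j in {-1, 0, 1} and e_j = 0 for
   j < N.  If K is the largest index with e_K != 0, then |m| >= (2/3) 4^K and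
   0 < |n| <= 2^(K+1), which for N large is incompatible with staying in the
   1/2-tunnel of a given line.

   Ergodicity: the orbit of an irrational x is x + Z[1/2], so an invariant set A
   has A `&` ]u, v] of measure c (v - u); covering A `&` ]0, 1], which has
   measure c, by intervals of total length l gives c <= c l, so that c > 0
   forces l >= 1 for every cover, i.e. c = 1.
   Recurrence: if A = A1 `|` A2 with both parts of positive measure, the orbit
   of A1 is conull by ergodicity, hence meets A2. *)

Require Import Defs.
From HB Require Import structures.
From mathcomp Require Import all_boot all_order all_algebra.
From mathcomp Require Import all_classical all_reals all_analysis.
From mathcomp Require Import ring lra zify.
Set Implicit Arguments.
Unset Strict Implicit.
Unset Printing Implicit Defensive.
Import Order.TTheory GRing.Theory Num.Theory.
Import numFieldNormedType.Exports.

Local Open Scope classical_set_scope.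
Local Open Scope ring_scope.

(** * Binary digits *)

Definition dyadic_floor (R : realType) (k : nat) (x : R) : int :=
  Num.floor (2 ^+ k * x).

Definition digit (R : realType) (k : nat) (x : R) : int :=
  dyadic_floor k.+1 x - 2 * dyadic_floor k x.

Section digits.
Variable R : realType.
Implicit Types (x : R) (i j k m : nat).

Lemma exp2_gt0 k : 0 < 2 ^+ k :> R.
Proof. by rewrite exprn_gt0. Qed.

Lemma exp2z k : (2 ^+ k)%:~R = 2 ^+ k :> R.
Proof. by rewrite rmorphXn. Qed.

Lemma dyadic_floor_itv k x :
  (dyadic_floor k x)%:~R <= 2 ^+ k * x < (dyadic_floor k x)%:~R + 1.
Proof. by have := floor_itv (2 ^+ k * x); rewrite intrD. Qed.

Lemma dyadic_floor_shift k x (a : int) :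
  dyadic_floor k (x + a%:~R / 2 ^+ k) = dyadic_floor k x + a.
Proof.
rewrite /dyadic_floor mulrDr mulrCA divff ?gt_eqF ?exp2_gt0// mulr1.
by rewrite floorDrz ?intr_int// intrKfloor.
Qed.

(** Since [r] is an integer below [2 ^+ m], also [r + 1 <= 2 ^+ m]; dividing the bounds on
    [2 ^+ (j + m) * x] by [2 ^+ m] then puts [2 ^+ j * x] in [[a, a + 1[]. *)
Lemma dyadic_floor_coarsen j m x (a r : int) : 0 <= r < 2 ^+ m ->
  dyadic_floor (j + m) x = 2 ^+ m * a + r -> dyadic_floor j x = a.
Proof.
move=> /andP[r0 rm] e; apply: floor_def; have := dyadic_floor_itv (j + m) x.
rewrite e exprD [(_ + r)%:~R]intrD intrM exp2z => /andP[].
have r0' : 0 <= r%:~R :> R by rewrite ler0z.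
have rm' : r%:~R + 1 <= 2 ^+ m :> R.
  by rewrite -exp2z -intrD1 ler_int; lia.
move=> h1 h2; have p := exp2_gt0 m; rewrite intrD; apply/andP; split.
  by rewrite -(ler_pM2l p); lra.
by rewrite -(ltr_pM2l p); lra.
Qed.

Lemma digit01 k x : digit k x = 0 \/ digit k x = 1.
Proof.
have e : dyadic_floor (k + 1) x =
    2 ^+ 1 * (dyadic_floor (k + 1) x %/ 2)%Z + (dyadic_floor (k + 1) x %% 2)%Z.
  by rewrite expr1 mulrC -divz_eq.
have := @dyadic_floor_coarsen k 1 x _ _ _ e.
rewrite expr1 => /(_ ltac:(lia)) e'.
by rewrite /digit e' -addn1; lia.
Qed.

(** At levels above [k] the translation moves the floor by an integer that doubles from one level to
    the next, and [digit] cancels it. *)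
Lemma digit_shift j k x (a : int) : (k < j)%N ->
  digit j (x + a%:~R / 2 ^+ k.+1) = digit j x.
Proof.
move=> kj.
have s l : (k < l)%N -> dyadic_floor l (x + a%:~R / 2 ^+ k.+1) =
    dyadic_floor l x + a * 2 ^+ (l - k.+1).
  move=> kl; rewrite -dyadic_floor_shift; congr (dyadic_floor _ (x + _)).
  rewrite intrM exp2z -{2}(subnK kl) exprD invfM.
  by rewrite -[RHS]mulrA (mulrA (2 ^+ _)) divff ?mul1r// gt_eqF// exp2_gt0.
rewrite /digit !s//; last by lia.
by rewrite (_ : (j.+1 - k.+1 = (j - k.+1).+1)%N); [rewrite exprS; lia|lia].
Qed.

Lemma digit_shiftz j x (a : int) : digit j (x + a%:~R) = digit j x.
Proof.
have s l : dyadic_floor l (x + a%:~R) = dyadic_floor l x + a * 2 ^+ l.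
  rewrite -dyadic_floor_shift; congr (dyadic_floor _ (x + _)).
  by rewrite intrM exp2z mulfK// gt_eqF// exp2_gt0.
by rewrite /digit !s exprS; lia.
Qed.

Lemma dyadic_floor0_shiftz x (a : int) :
  dyadic_floor 0 (x + a%:~R) = dyadic_floor 0 x + a.
Proof. by rewrite -dyadic_floor_shift expr0 divr1. Qed.

Lemma digits1 k x : (forall j, (j < k)%N -> digit j x = 1) ->
  dyadic_floor k x = 2 ^+ k * (dyadic_floor 0 x + 1) - 1.
Proof.
elim: k => [|k IH] h; first by rewrite expr0; lia.
have := h k (ltnSn k); rewrite /digit IH; last by move=> j jk; apply: h; lia.
by rewrite exprS; lia.
Qed.

Lemma digits0 k x : (forall j, (j < k)%N -> digit j x = 0) ->
  dyadic_floor k x = 2 ^+ k * dyadic_floor 0 x.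
Proof.
elim: k => [|k IH] h; first by rewrite expr0; lia.
have := h k (ltnSn k); rewrite /digit IH; last by move=> j jk; apply: h; lia.
by rewrite exprS; lia.
Qed.

Lemma exp2_unbounded (y : R) : exists k, y < 2 ^+ k.
Proof.
exists (Num.bound y); exact: upper_nthrootP. Qed.

Lemma small_eq0 (y : R) : 0 <= y -> (forall k, 2 ^+ k * y <= 1) -> y = 0.
Proof.
move=> y0 h; apply/eqP/negP => /negP yn0.
have yp : 0 < y by rewrite lt_neqAle eq_sym yn0.
have [k] := exp2_unbounded y^-1.
by rewrite -(ltr_pM2r yp) mulVf// ltNge h.
Qed.

(** If all digits were 1, [x] would be within [2 ^- k] of the integer [floor x + 1] for every [k],
    hence equal to it. *)
Lemma exists_digit0 x : ~ rational x -> exists k, digit k x = 0.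
Proof.
move=> irr; apply: contrapT => /forallNP h; apply: irr.
have e k : dyadic_floor k x = 2 ^+ k * (dyadic_floor 0 x + 1) - 1.
  by apply: digits1 => j _; have [/h|] := digit01 j x.
suff : (dyadic_floor 0 x + 1)%:~R - x = 0.
  move/subr0_eq => <-; apply/rationalP; exists (dyadic_floor 0 x + 1), 1%N.
  by rewrite divr1.
apply: small_eq0 => [|k].
  by have := dyadic_floor_itv 0 x; rewrite expr0 intrD; lra.
have := dyadic_floor_itv k x; rewrite e intrB intrM exp2z.
by rewrite !intrD; lra.
Qed.

Lemma exists_digit1 x : ~ rational x -> exists k, digit k x = 1.
Proof.
move=> irr; apply: contrapT => /forallNP h; apply: irr.
have e k : dyadic_floor k x = 2 ^+ k * (dyadic_floor 0 x).
  by apply: digits0 => j _; have [//|/h] := digit01 j x.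
suff : x - (dyadic_floor 0 x)%:~R = 0.
  move/subr0_eq => ->; apply/rationalP; exists (dyadic_floor 0 x), 1%N.
  by rewrite divr1.
apply: small_eq0 => [|k].
  by have := dyadic_floor_itv 0 x; rewrite expr0; lra.
have := dyadic_floor_itv k x; rewrite e intrM exp2z.
by lra.
Qed.

End digits.

(** * The pieces on which the odometer is a translation *)

Section odometer_pieces.
Variable R : realType.
Implicit Types (x : R) (i j k m : nat).

(* The binary expansion of the fractional part starts with 1^k 0. *)
Definition ones_piece k : set R := [set x | ~ rational x /\
  exists a : int, dyadic_floor k.+1 x = 2 ^+ k.+1 * a - 2].

(* The binary expansion of the fractional part starts with 0^k 1. *)
Definition zeros_piece k : set R := [set x | ~ rational x /\
  exists a : int, dyadic_floor k.+1 x = 2 ^+ k.+1 * a + 1].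

(** The change of the base 4 digit sum when the digits 1^k 0 become 0^k 1. *)
Definition carry k : int := 4 ^+ k - \sum_(j < k) 4 ^+ j.

(* The dyadic translation turning 1^k 0 into 0^k 1 and lowering the integer
   part by [carry k], so that [floor x + \sum_j 4 ^+ j * digit j x] is kept. *)
Definition jump k : R :=
  (3 - 2 ^+ k.+1 * (1 + carry k))%:~R / 2 ^+ k.+1.

Definition digit_sum (w : nat -> int) m x : int :=
  \sum_(j < m) digit j x * w j.

Lemma rationalD x (y : R) : rational x -> rational y -> rational (x + y).
Proof. by move=> [p _ <-] [q _ <-]; exists (p + q) => //; rewrite rmorphD. Qed.

Lemma rationalN x : rational x -> rational (- x).
Proof. by move=> [p _ <-]; exists (- p) => //; rewrite rmorphN. Qed.

Lemma rational_dyadic (a : int) k : rational (a%:~R / 2 ^+ k : R).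
Proof. by apply/rationalP; exists a, (2 ^ k)%N; rewrite natrX. Qed.

Lemma rational_int (a : int) : rational (a%:~R : R).
Proof. by have := rational_dyadic a 0; rewrite expr0 divr1. Qed.

Lemma rational_shift x (y : R) : rational y -> rational (x + y) <-> rational x.
Proof.
move=> ry; split=> [rxy|rx]; last exact: rationalD.
by rewrite -(addrK y x); apply: rationalD => //; exact: rationalN.
Qed.

Lemma ones_piece_floor k x (a : int) j :
  dyadic_floor k.+1 x = 2 ^+ k.+1 * a - 2 -> (j <= k)%N ->
  dyadic_floor j x = 2 ^+ j * a - 1.
Proof.
(* The remainder comes from writing [2 ^+ k.+1 * a - 2] as [2 ^+ (k.+1 - j) * (2 ^+ j * a - 1) + (2
   ^+ (k.+1 - j) - 2)]; in particular the integer part is [a - 1]. *)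
move=> e jk; apply: (@dyadic_floor_coarsen _ _ (k.+1 - j) _ _
  (2 ^+ (k.+1 - j) - 2)).
  by rewrite subSn// exprS; have := exprn_gt0 (k - j) (ltr0Sn int 1); lia.
rewrite subnKC// ?e; last by lia.
rewrite (_ : 2 ^+ k.+1 = 2 ^+ (k.+1 - j) * 2 ^+ j :> int); last first.
  by rewrite -exprD subnK//; lia.
by ring.
Qed.

Lemma zeros_piece_floor k x (a : int) j :
  dyadic_floor k.+1 x = 2 ^+ k.+1 * a + 1 -> (j <= k)%N ->
  dyadic_floor j x = 2 ^+ j * a.
Proof.
move=> e jk; apply: (@dyadic_floor_coarsen _ _ (k.+1 - j) _ _ 1).
  by rewrite subSn// exprS; have := exprn_gt0 (k - j) (ltr0Sn int 1); lia.
rewrite subnKC// ?e; last by lia.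
rewrite (_ : 2 ^+ k.+1 = 2 ^+ (k.+1 - j) * 2 ^+ j :> int); last first.
  by rewrite -exprD subnK//; lia.
by ring.
Qed.

Lemma ones_pieceP k x : ones_piece k x <->
  [/\ ~ rational x, forall j, (j < k)%N -> digit j x = 1 & digit k x = 0].
Proof.
split=> [[irr [a e]]|[irr d1 d0]]; split=> //.
- move=> j jk; rewrite /digit !(ones_piece_floor e)//; last by lia.
  by rewrite exprS; lia.
- by rewrite /digit e (ones_piece_floor e)// exprS; lia.
- exists (dyadic_floor 0 x + 1); have := digits1 d1.
  by move: d0; rewrite /digit exprS; lia.
Qed.

Lemma zeros_pieceP k x : zeros_piece k x <->
  [/\ ~ rational x, forall j, (j < k)%N -> digit j x = 0 & digit k x = 1].
Proof.
split=> [[irr [a e]]|[irr d1 d0]]; split=> //.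
- move=> j jk; rewrite /digit !(zeros_piece_floor e)//; last by lia.
  by rewrite exprS; lia.
- by rewrite /digit e (zeros_piece_floor e)// exprS; lia.
- exists (dyadic_floor 0 x); have := digits0 d1.
  by move: d0; rewrite /digit exprS; lia.
Qed.

(** At level [k.+1] the floor passes from [2 ^+ k.+1 * a - 2] to
    [2 ^+ k.+1 * (a - 1 - carry k) + 1], which accounts for the 3 in [jump]. *)
Lemma ones_piece_jump k x : ones_piece k x -> zeros_piece k (x + jump k).
Proof.
move=> [irr [a e]]; split.
  by move=> /(rational_shift x (rational_dyadic _ _)).
by exists (a - (1 + carry k)); rewrite dyadic_floor_shift e; ring.
Qed.

Lemma zeros_piece_jump k x : zeros_piece k x -> ones_piece k (x - jump k).
Proof.
move=> [irr [a e]]; rewrite /jump -mulNr -rmorphN; split.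
  by move=> /(rational_shift x (rational_dyadic _ _)).
by exists (a + (1 + carry k)); rewrite dyadic_floor_shift e; ring.
Qed.

Lemma floor_jump k x : ones_piece k x ->
  dyadic_floor 0 (x + jump k) = dyadic_floor 0 x - carry k.
Proof.
move=> [irr [a e]]; rewrite (ones_piece_floor e)//.
rewrite (@zeros_piece_floor k (x + jump k) (a - (1 + carry k)))//.
  by rewrite expr0; ring.
by rewrite dyadic_floor_shift e; ring.
Qed.

(** The digits below [k] pass from 1 to 0, digit [k] from 0 to 1, and higher ones stay. The net gain
    is 1 for the weights [2 ^+ j] and [carry k] for [4 ^+ j]. *)
Lemma digit_sum_jump (w : nat -> int) k m x : ones_piece k x -> (k < m)%N ->
  digit_sum w m (x + jump k) = digit_sum w m x + w k - \sum_(j < k) w j.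
Proof.
move=> Px; have /zeros_pieceP[_ z1 z2] := ones_piece_jump Px.
have /ones_pieceP[_ o1 o2] := Px.
elim: m => // m IH; rewrite ltnS leq_eqVlt => /orP[/eqP e|km]; last first.
  rewrite /digit_sum !big_ord_recr/= -!/(digit_sum _ _ _) IH//.
  by rewrite digit_shift//; ring.
rewrite -e /digit_sum !big_ord_recr/= z2 o2 [X in X + _]big1; last first.
  by move=> j _; rewrite z1 ?mul0r.
rewrite [\sum_(j < k) digit j x * w j](eq_bigr (fun j : 'I_k => w j)).
  by ring.
by move=> j _; rewrite o1 ?mul1r.
Qed.

(** The piece of an irrational point is given by the position of its first digit 0. *)
Lemma bigcup_ones_piece : \bigcup_k ones_piece k = ~` rational.
Proof.
apply/seteqP; split=> [x [k _ []]//|x irr].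
have [k0 dk0] := exists_digit0 irr.
have ex : exists k, digit k x == 0 by exists k0; apply/eqP.
case: (ex_minnP ex) => k /eqP dk kmin; exists k => //.
apply/ones_pieceP; split=> // j jk.
by have [/eqP /kmin|//] := digit01 j x; lia.
Qed.

Lemma bigcup_zeros_piece : \bigcup_k zeros_piece k = ~` rational.
Proof.
apply/seteqP; split=> [x [k _ []]//|x irr].
have [k0 dk0] := exists_digit1 irr.
have ex : exists k, digit k x == 1 by exists k0; apply/eqP.
case: (ex_minnP ex) => k /eqP dk kmin; exists k => //.
apply/zeros_pieceP; split=> // j jk.
by have [//|/eqP /kmin] := digit01 j x; lia.
Qed.

Lemma trivIset_ones_piece : trivIset setT ones_piece.
Proof.
apply/trivIsetP => i j _ _; wlog : i j / (i < j)%N.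
  move=> H; rewrite neq_ltn => /orP[ij|ji]; first by apply: H; lia.
  by rewrite setIC; apply: H; lia.
move=> ij _; apply/seteqP; split=> // x [/ones_pieceP[_ _ x0]].
by move=> /ones_pieceP[_ /(_ _ ij)]; rewrite x0.
Qed.

Lemma trivIset_zeros_piece : trivIset setT zeros_piece.
Proof.
apply/trivIsetP => i j _ _; wlog : i j / (i < j)%N.
  move=> H; rewrite neq_ltn => /orP[ij|ji]; first by apply: H; lia.
  by rewrite setIC; apply: H; lia.
move=> ij _; apply/seteqP; split=> // x [/zeros_pieceP[_ _ x0]].
by move=> /zeros_pieceP[_ /(_ _ ij)]; rewrite x0.
Qed.

End odometer_pieces.

(** * Translation invariance of Lebesgue measure *)

Section lebesgue_shift.
Variable R : realType.
Local Notation leb := (@completed_lebesgue_measure R).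
Local Notation XR := (caratheodory_type (wlength (@idfun R))^*%mu).

Definition shift (c x : R) : R := x + c.

Lemma shift_preimage_ocitv (c : R) (I : set R) : ocitv I ->
  ocitv (shift c @^-1` I) /\ wlength idfun (shift c @^-1` I) = wlength idfun I.
Proof.
move=> [[a b] _ <-] /=.
have -> : shift c @^-1` `]a, b]%classic = `]a - c, b - c]%classic.
  apply/seteqP; split=> x /=; rewrite /shift !in_itv/= => /andP[? ?];
    by apply/andP; split; lra.
split; first exact: is_ocitv.
have [ab|ba] := leP a b.
  by rewrite !wlength_itv_bnd//= ?lerB//; congr (_%:E); lra.
have e (u v : R) : v < u -> `]u, v]%classic = set0 :> set R.
  by move=> vu; rewrite set_itv_ge// bnd_simp -leNgt ltW.
by rewrite !e// ltrD2r.
Qed.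

Lemma shiftK (c : R) (A : set R) : shift c @^-1` (shift (- c) @^-1` A) = A.
Proof. by apply/seteqP; split=> x /=; rewrite /shift addrK. Qed.

(** [leb] is the outer measure given by covers with half-open intervals, and covers translate at
    equal cost; applying the resulting inequality to [c] and [- c] gives equality, for arbitrary
    sets. *)
Lemma completed_lebesgue_measure_shift (c : R) (A : set R) :
  leb (shift c @^-1` A) = leb A.
Proof.
have le (d : R) (B : set R) : (leb (shift d @^-1` B) <= leb B)%E.
  apply: le_ereal_inf_tmp => _ [F [mF BF] <-].
  apply: ereal_inf_lbound; exists (fun k => shift d @^-1` F k).
    split=> [k|x Bx]; first exact: (shift_preimage_ocitv d (mF k)).1.
    by have [k _ Fk] := BF _ Bx; exists k.
  apply: eq_eseriesr => k _; exact: (shift_preimage_ocitv d (mF k)).2.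
apply/eqP; rewrite eq_le le/=.
by rewrite -{1}(shiftK (- c) A) opprK; exact: le.
Qed.

(** The Caratheodory criterion for the translate, tested on [B], is the criterion for [A] tested on
    [B] translated back. *)
Lemma measurable_shift (c : R) (A : set XR) :
  measurable A -> measurable (shift c @^-1` A : set XR).
Proof.
move=> mA; suff : caratheodory_measurable leb (shift c @^-1` A) by [].
move=> B; have := (mA : caratheodory_measurable leb A) (shift (- c) @^-1` B).
rewrite -[in LHS](completed_lebesgue_measure_shift c)
  -[X in (X + _)%E](completed_lebesgue_measure_shift c)
  -[X in (_ + X)%E](completed_lebesgue_measure_shift c).
by rewrite !preimage_setI preimage_setC shiftK.
Qed.

End lebesgue_shift.

Section lebesgue_facts.
Variable R : realType.
Local Notation leb := (@completed_lebesgue_measure R).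
Local Notation XR := (caratheodory_type (wlength (@idfun R))^*%mu).

Lemma completed_borel_measurable (A : set R) :
  measurable A -> measurable (A : set XR).
Proof. exact: sub_caratheodory. Qed.

Lemma completed_itv_measurable (i : interval R) :
  measurable ([set` i] : set XR).
Proof. by apply: completed_borel_measurable; exact: measurable_itv. Qed.

Lemma completed_lebesgue_measure_itv (i : interval R) :
  leb [set` i] = if (i.1 < i.2)%E then (i.2 - i.1)%E else 0%E.
Proof. exact: lebesgue_measure_itv. Qed.

Lemma countable_rational : countable (@rational R).
Proof. exact: card_le_trans (card_image_le _ _) (countableP _). Qed.

Lemma rational_measurable : measurable (@rational R : set XR).
Proof.
apply: completed_borel_measurable; apply: countable_measurable => //.
exact: countable_rational.
Qed.

Lemma completed_lebesgue_measure_rational : leb rational = 0%E.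
Proof. by apply: countable_lebesgue_measure0; exact: countable_rational. Qed.

End lebesgue_facts.

(** * Piecewise translations *)

Section piecewise_shift.
Variable R : realType.
Local Notation leb := (@completed_lebesgue_measure R).
Local Notation XR := (caratheodory_type (wlength (@idfun R))^*%mu).
Implicit Types (P Q : nat -> set R) (u : nat -> R).

Definition piecewise_shift P u (x : R) : R :=
  if pselect (exists k, P k x) is left e then x + u (projT1 (cid e)) else x.

Lemma piecewise_shiftE P u k x : trivIset setT P -> P k x ->
  piecewise_shift P u x = x + u k.
Proof.
move=> tP Pkx; rewrite /piecewise_shift; case: pselect => [e|]; last first.
  by move=> /forallNP /(_ k).
case: cid => l /= Plx; congr (_ + u _).
by apply: (tP l k) => //; exists x.
Qed.

Lemma piecewise_shift_id P u x : ~ (\bigcup_k P k) x ->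
  piecewise_shift P u x = x.
Proof.
move=> h; rewrite /piecewise_shift; case: pselect => // -[k Pkx].
by case: h; exists k.
Qed.

Lemma piecewise_shiftK P Q u v : trivIset setT P -> trivIset setT Q ->
  (forall k x, P k x -> Q k (x + u k)) -> (forall k, v k = - u k) ->
  \bigcup_k P k = \bigcup_k Q k ->
  cancel (piecewise_shift P u) (piecewise_shift Q v).
Proof.
move=> tP tQ PQ vu UPQ x; have [[k _ Pkx]|h] := pselect ((\bigcup_k P k) x).
  rewrite (piecewise_shiftE u tP Pkx) (piecewise_shiftE v tQ (PQ _ _ Pkx)).
  by rewrite vu addrK.
by rewrite !piecewise_shift_id// -UPQ.
Qed.

Lemma piecewise_shift_preimage P u (A : set R) : trivIset setT P ->
  piecewise_shift P u @^-1` A =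
  (A `\` \bigcup_k P k) `|` \bigcup_k (P k `&` shift (u k) @^-1` A).
Proof.
move=> tP; apply/seteqP; split=> x /=.
  have [[k _ Pkx]|h] := pselect ((\bigcup_k P k) x).
    by rewrite (piecewise_shiftE u tP Pkx); right; exists k.
  by rewrite piecewise_shift_id//; left.
move=> [[Ax h]|[k _ [Pkx Ax]]]; first by rewrite piecewise_shift_id.
by rewrite (piecewise_shiftE u tP Pkx).
Qed.

Lemma measurable_piecewise_shift P u (A : set XR) : trivIset setT P ->
  (forall k, measurable (P k : set XR)) -> measurable A ->
  measurable (piecewise_shift P u @^-1` A : set XR).
Proof.
move=> tP mP mA; rewrite piecewise_shift_preimage//; apply: measurableU.
  by apply: measurableD => //; exact: bigcupT_measurable.
by apply: bigcupT_measurable => k; apply: measurableI => //;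
  exact: measurable_shift.
Qed.

(** Off the pieces the map is the identity; on [P k] the preimage of [A] is a translate of
    [A]&[Q k]. Countable additivity over both partitions concludes. *)
Lemma completed_lebesgue_measure_piecewise_shift P Q u (A : set XR) :
  trivIset setT P -> trivIset setT Q ->
  (forall k, measurable (P k : set XR)) ->
  (forall k, measurable (Q k : set XR)) ->
  (forall k, P k = shift (u k) @^-1` Q k) ->
  \bigcup_k P k = \bigcup_k Q k -> measurable A ->
  leb (piecewise_shift P u @^-1` A) = leb A.
Proof.
move=> tP tQ mP mQ PQ UPQ mA; rewrite piecewise_shift_preimage//.
have mPA k : measurable (P k `&` shift (u k) @^-1` A : set XR).
  by apply: measurableI => //; exact: measurable_shift.
have mQA k : measurable (A `&` Q k : set XR) by exact: measurableI.
have mUP : measurable (\bigcup_k P k : set XR) by exact: bigcupT_measurable.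
rewrite (measureDI leb mA (bigcupT_measurable _ mQ)) -UPQ.
rewrite [X in X = _]measureU//; last 3 first.
- exact: measurableD.
- exact: bigcupT_measurable.
- by apply/seteqP; split=> // x [[_ nPx] [k _ [Pkx _]]]; apply: nPx; exists k.
congr (_ + _)%E; rewrite UPQ setI_bigcupr.
transitivity (\sum_(0 <= k <oo | k \in setT)
    leb (P k `&` shift (u k) @^-1` A))%E.
  apply: measure_bigcup => // i j _ _ [x [[Pi _] [Pj _]]].
  by apply: tP => //; exists x.
transitivity (\sum_(0 <= k <oo | k \in setT) leb (A `&` Q k))%E; last first.
  apply/esym/measure_bigcup => // i j _ _ [x [[_ Qi] [_ Qj]]].
  by apply: tQ => //; exists x.
apply: eq_eseriesr => k _.
by rewrite PQ -preimage_setI completed_lebesgue_measure_shift setIC.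
Qed.

End piecewise_shift.

(** * The action *)

Section integer_iteration.
Variables (T : Type) (f g : T -> T).

Definition iterz (n : int) : T -> T :=
  match n with Posz k => iter k f | Negz k => iter k.+1 g end.

(** The predicate bears on the whole map, so that properties such as measure preservation pass from
    the two generators to all powers. *)
Lemma iterz_ind (P : int -> (T -> T) -> Prop) : P 0 id ->
  (forall n h, P n h -> P (n + 1) (f \o h)) ->
  (forall n h, P n h -> P (n - 1) (g \o h)) ->
  forall n, P n (iterz n).
Proof.
move=> P0 PS PP [] n.
- elim: n => [//|n IH]; have := PS _ _ IH.
  by rewrite (_ : Posz n + 1 = n.+1); [|lia].
- elim: n => [|n IH]; first exact: (PP 0 id).
  by have := PP _ _ IH; rewrite (_ : Negz n - 1 = Negz n.+1); [|lia].
Qed.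

Hypotheses (fK : cancel f g) (gK : cancel g f).

Lemma iterz_add1 n x : iterz (n + 1) x = f (iterz n x).
Proof.
case: n => [n|[|n]]; first by rewrite (_ : Posz n + 1 = n.+1)//; lia.
  by rewrite /= gK.
by rewrite (_ : Negz n.+1 + 1 = Negz n) /= ?gK//; lia.
Qed.

Lemma iterz_sub1 n x : iterz (n - 1) x = g (iterz n x).
Proof. by rewrite -{2}(subrK 1 n) iterz_add1 fK. Qed.

Lemma iterzD m n x : iterz (m + n) x = iterz m (iterz n x).
Proof.
move: m n x; pose P m (h : T -> T) := forall n x, iterz (m + n) x = h (iterz n x).
apply: (@iterz_ind P) => [n x|m h IH n x|m h IH n x].
- by rewrite add0r.
- by rewrite addrAC iterz_add1 IH.
- by rewrite addrAC iterz_sub1 IH.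
Qed.

End integer_iteration.

(** * The odometer and the action it generates with the unit translation *)

Section odometer_action.
Variable R : realType.
Local Notation leb := (@completed_lebesgue_measure R).
Local Notation XR := (caratheodory_type (wlength (@idfun R))^*%mu).
Implicit Types (x y : R) (n : int * int).

Lemma measurable_dyadic_floor k (a : int) :
  measurable ([set x | dyadic_floor k x = a] : set XR).
Proof.
have -> : [set x | dyadic_floor k x = a] =
    `[a%:~R / 2 ^+ k, (a%:~R + 1) / 2 ^+ k[%classic :> set R.
  apply/seteqP; split=> x /=; have p := @exp2_gt0 R k;
    rewrite in_itv/= ler_pdivrMr// ltr_pdivlMr// mulrC => h.
    by rewrite -h; exact: dyadic_floor_itv.
  by apply: floor_def; rewrite intrD.
exact: completed_itv_measurable.
Qed.

Lemma measurable_ones_piece k : measurable (ones_piece k : set XR).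
Proof.
have -> : ones_piece k = ~` rational `&` \bigcup_(a in [set: int])
    [set x | dyadic_floor k.+1 x = 2 ^+ k.+1 * a - 2] :> set R.
  apply/seteqP; split=> x [irr]; first by move=> [a e]; split=> //; exists a.
  by move=> [a _ e]; split=> //; exists a.
apply: measurableI; first by apply: measurableC; exact: rational_measurable.
apply: countable_bigcupT_measurable => // a; exact: measurable_dyadic_floor.
Qed.

Lemma ones_zeros_piece k : ones_piece k = shift (jump R k) @^-1` zeros_piece k.
Proof.
apply/seteqP; split=> x /=; first exact: ones_piece_jump.
by move/zeros_piece_jump; rewrite addrK.
Qed.

Lemma zeros_ones_piece k : zeros_piece k = shift (- jump R k) @^-1` ones_piece k.
Proof. by rewrite ones_zeros_piece -{2}(opprK (jump R k)) shiftK. Qed.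

Lemma measurable_zeros_piece k : measurable (zeros_piece k : set XR).
Proof.
rewrite zeros_ones_piece; apply: measurable_shift.
exact: measurable_ones_piece.
Qed.

Lemma bigcup_pieces : \bigcup_k @ones_piece R k = \bigcup_k zeros_piece k.
Proof. by rewrite bigcup_ones_piece bigcup_zeros_piece. Qed.

Definition odometer : R -> R := piecewise_shift (@ones_piece R) (@jump R).

Definition odometer_inv : R -> R :=
  piecewise_shift (@zeros_piece R) (fun k => - jump R k).

Lemma odometerK : cancel odometer odometer_inv.
Proof.
apply: piecewise_shiftK => //; first exact: trivIset_ones_piece.
- exact: trivIset_zeros_piece.
- by move=> k x /ones_piece_jump.
- exact: bigcup_pieces.
Qed.

Lemma odometer_invK : cancel odometer_inv odometer.
Proof.
apply: piecewise_shiftK => //; first exact: trivIset_zeros_piece.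
- exact: trivIset_ones_piece.
- by move=> k x /zeros_piece_jump.
- by move=> k; rewrite opprK.
- exact/esym/bigcup_pieces.
Qed.

Lemma measurable_odometer (A : set XR) :
  measurable A -> measurable (odometer @^-1` A : set XR).
Proof.
apply: measurable_piecewise_shift; first exact: trivIset_ones_piece.
exact: measurable_ones_piece.
Qed.

Lemma measurable_odometer_inv (A : set XR) :
  measurable A -> measurable (odometer_inv @^-1` A : set XR).
Proof.
apply: measurable_piecewise_shift; first exact: trivIset_zeros_piece.
exact: measurable_zeros_piece.
Qed.

Lemma odometer_preserving (A : set XR) : measurable A ->
  leb (odometer @^-1` A) = leb A.
Proof.
apply: completed_lebesgue_measure_piecewise_shift.
- exact: trivIset_ones_piece.
- exact: trivIset_zeros_piece.
- exact: measurable_ones_piece.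
- exact: measurable_zeros_piece.
- exact: ones_zeros_piece.
- exact: bigcup_pieces.
Qed.

Lemma odometer_inv_preserving (A : set XR) : measurable A ->
  leb (odometer_inv @^-1` A) = leb A.
Proof.
move=> mA; rewrite -odometer_preserving; last exact: measurable_odometer_inv.
congr (leb _).
by apply/seteqP; split=> x /=; rewrite odometerK.
Qed.

Lemma odometerE k x : ones_piece k x -> odometer x = x + jump R k.
Proof. apply: piecewise_shiftE; exact: trivIset_ones_piece. Qed.

Lemma odometer_rational x : rational x -> odometer x = x.
Proof. by move=> rx; apply: piecewise_shift_id; rewrite bigcup_ones_piece. Qed.

Lemma ones_piece_shiftz k x (a : int) :
  ones_piece k x -> ones_piece k (x + a%:~R).
Proof.
move=> /ones_pieceP[irr o1 o2]; apply/ones_pieceP; split.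
- by move=> /(rational_shift x (rational_int _ a)).
- by move=> j jk; rewrite digit_shiftz o1.
- by rewrite digit_shiftz o2.
Qed.

(** The two generators commute, because the pieces depend only on digits, which integer translations
    preserve. *)
Lemma odometer_shiftz x (a : int) : odometer (x + a%:~R) = odometer x + a%:~R.
Proof.
have [rx|irr] := pselect (rational x).
  by rewrite !odometer_rational//; apply: rationalD => //; exact: rational_int.
have [k _ Pk] : (\bigcup_k ones_piece k) x by rewrite bigcup_ones_piece.
by rewrite (odometerE Pk) (odometerE (ones_piece_shiftz _ Pk)) addrAC.
Qed.

Lemma odometer_inv_shiftz x (a : int) :
  odometer_inv (x + a%:~R) = odometer_inv x + a%:~R.
Proof.
by apply: (can_inj odometerK); rewrite odometer_shiftz !odometer_invK.
Qed.

Definition odometer_action n x : R :=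
  iterz odometer odometer_inv n.1 (x + n.2%:~R).

Lemma iterz_odometer_shiftz (m : int) x (a : int) :
  iterz odometer odometer_inv m (x + a%:~R) =
  iterz odometer odometer_inv m x + a%:~R.
Proof.
move: m x a; pose P (m : int) (h : R -> R) :=
  forall x (a : int), h (x + a%:~R) = h x + a%:~R.
apply: (@iterz_ind _ _ _ P) => // m h IH x a /=; rewrite IH.
  exact: odometer_shiftz.
exact: odometer_inv_shiftz.
Qed.

Lemma odometer_actionD m n x :
  odometer_action (m + n) x = odometer_action m (odometer_action n x).
Proof.
rewrite /odometer_action /= -iterz_odometer_shiftz.
rewrite -(iterzD odometerK odometer_invK) intrD; congr (iterz _ _ _ _).
by rewrite -addrA; congr (x + _); rewrite addrC.
Qed.

Lemma odometer_action0 : odometer_action 0 = id.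
Proof. by apply/funext => x; rewrite /odometer_action /= addr0. Qed.

Lemma odometer_action_measurable_preserving n (A : set XR) : measurable A ->
  measurable (odometer_action n @^-1` A : set XR) /\
  leb (odometer_action n @^-1` A) = leb A.
Proof.
move=> mA.
have [mB eB] : measurable (iterz odometer odometer_inv n.1 @^-1` A : set XR) /\
    leb (iterz odometer odometer_inv n.1 @^-1` A) = leb A.
  (* Both properties are carried together, since preservation by one more generator applies only to
     measurable sets. *)
  move: n.1; pose P (m : int) (h : R -> R) :=
    forall B : set XR, measurable B ->
      measurable (h @^-1` B : set XR) /\ leb (h @^-1` B) = leb B.
  move=> m; apply: (@iterz_ind _ _ _ P _ _ _ m A mA) => // {}m h IH B mB.
  - have [mh eh] := IH _ (measurable_odometer mB); split; first exact: mh.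
    by rewrite -(odometer_preserving mB) -eh.
  - have [mh eh] := IH _ (measurable_odometer_inv mB); split; first exact: mh.
    by rewrite -(odometer_inv_preserving mB) -eh.
have -> : odometer_action n @^-1` A =
    shift n.2%:~R @^-1` (iterz odometer odometer_inv n.1 @^-1` A) by [].
by rewrite completed_lebesgue_measure_shift; split=> //; exact: measurable_shift.
Qed.

End odometer_action.

(** * Recovering the group element from two points of an orbit *)

Section odometer_cocycle.
Variable R : realType.
Implicit Types (x y : R) (n : int * int).

(* [n] is read off from any long enough block of binary digits of [x] and [y]:
   the two coordinates are the weighted digit sums that [odometer], resp. the
   unit translation, increases by 1 while leaving the other one unchanged. *)
Definition displacement n x y : Prop := exists K : nat, forall M, (K <= M)%N ->
  digit_sum (fun j => 2 ^+ j) M y = digit_sum (fun j => 2 ^+ j) M x + n.1 /\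
  dyadic_floor 0 y + digit_sum (fun j => 4 ^+ j) M y =
  dyadic_floor 0 x + digit_sum (fun j => 4 ^+ j) M x + n.2.

Lemma displacementD m n x y z : displacement m x y -> displacement n y z ->
  displacement (m + n) x z.
Proof.
move=> [K hK] [L hL]; exists (maxn K L) => M; rewrite geq_max => /andP[KM LM].
have [e1 e2] := hK _ KM; have [e3 e4] := hL _ LM.
by rewrite e3 e1 e4 e2 /= !addrA.
Qed.

Lemma displacement_opp n x y : displacement n x y -> displacement (- n) y x.
Proof.
move=> [K hK]; exists K => M /hK[e1 e2].
by rewrite e1 e2 /= !addrK.
Qed.

Lemma displacement_shiftz x (a : int) : displacement (0, a) x (x + a%:~R).
Proof.
exists 0%N => M _; rewrite dyadic_floor0_shiftz addr0 /digit_sum.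
split; first by apply: eq_bigr => j _; rewrite digit_shiftz.
rewrite addrAC; congr (_ + _ + _).
by apply: eq_bigr => j _; rewrite digit_shiftz.
Qed.

Lemma sum_exp2 k : \sum_(j < k) 2 ^+ j = 2 ^+ k - 1 :> int.
Proof.
elim: k => [|k IH]; first by rewrite big_ord0 expr0.
by rewrite big_ord_recr/= IH exprS; lia.
Qed.

(** On piece [k] the base 2 sum gains [2 ^+ k - (2 ^+ k - 1) = 1], while the gain [carry k] of the
    base 4 sum is offset by the drop of the integer part. *)
Lemma odometer_displacement x : ~ rational x ->
  ~ rational (odometer x) /\ displacement (1, 0) x (odometer x).
Proof.
move=> irr.
have [k _ Pk] : (\bigcup_k ones_piece k) x by rewrite bigcup_ones_piece.
rewrite (odometerE Pk); split; first by have [] := ones_piece_jump Pk.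
exists k.+1 => M kM; rewrite !digit_sum_jump//= floor_jump// sum_exp2 /carry.
by split; ring.
Qed.

Lemma odometer_inv_displacement x : ~ rational x ->
  ~ rational (odometer_inv x) /\ displacement (- (1, 0)) x (odometer_inv x).
Proof.
move=> irr.
have irr' : ~ rational (odometer_inv x).
  by move=> r; apply: irr; rewrite -(odometer_invK x) odometer_rational.
split=> //; apply: displacement_opp.
by have := (odometer_displacement irr').2; rewrite odometer_invK.
Qed.

Lemma odometer_action_displacement n x : ~ rational x ->
  ~ rational (odometer_action n x) /\ displacement n x (odometer_action n x).
Proof.
move=> irr; set y := x + n.2%:~R.
have irry : ~ rational y by move=> /(rational_shift x (rational_int _ _)).
suff [irrn dn] : ~ rational (odometer_action n x) /\
    displacement (n.1, 0) y (odometer_action n x).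
  split=> //; have := displacementD (displacement_shiftz x n.2) dn.
  rewrite [_ + _](_ : _ = (0 + n.1, n.2 + 0))// add0r addr0.
  by rewrite -surjective_pairing.
pose P (m : int) (h : R -> R) := forall y, ~ rational y ->
  ~ rational (h y) /\ displacement (m, 0) y (h y).
suff : P n.1 (iterz (@odometer R) (@odometer_inv R) n.1) by exact.
apply: iterz_ind.
- move=> z irrz; split=> //; exists 0%N => M _; rewrite !addr0//.
- move=> m h IH z /IH[/odometer_displacement[? d1] d2]; split=> //.
  have := displacementD d2 d1.
  by rewrite [_ + _](_ : _ = (m + 1, 0))//.
- move=> m h IH z /IH[/odometer_inv_displacement[? d1] d2]; split=> //.
  have := displacementD d2 d1.
  by rewrite [_ + _](_ : _ = (m - 1, 0))//.
Qed.

Lemma signed_sum_bounds (e : nat -> int) M :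
  (forall j, -1 <= e j <= 1) ->
  `|\sum_(j < M) e j * 2 ^+ j| <= 2 ^+ M - 1 /\
  3 * `|\sum_(j < M) e j * 4 ^+ j| <= 4 ^+ M - 1.
Proof.
move=> he; elim: M => [|M [IH1 IH2]]; first by rewrite !big_ord0 !expr0.
rewrite !big_ord_recr/= !exprS.
have p2 : 0 < 2 ^+ M :> int by rewrite exprn_gt0.
have p4 : 0 < 4 ^+ M :> int by rewrite exprn_gt0.
have {he} : e M = -1 \/ e M = 0 \/ e M = 1 by have := he M; lia.
move: (\sum_(j < M) e j * 2 ^+ j) (\sum_(j < M) e j * 4 ^+ j) (2 ^+ M) (4 ^+ M)
  IH1 IH2 p2 p4 => a b p q IH1 IH2 p0 q0.
by move=> [->|[->|->]]; split; lia.
Qed.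

(** The term of largest index [K] with [e K != 0] dominates: the lower terms add up to at most
    [2 ^+ K - 1], resp. [(4 ^+ K - 1) / 3], in absolute value. *)
Lemma signed_sum_leading (e : nat -> int) M :
  (forall j, -1 <= e j <= 1) ->
  (forall j, (j < M)%N -> e j = 0) \/
  exists K : nat, [/\ e K != 0,
    1 <= `|\sum_(j < M) e j * 2 ^+ j| <= 2 * 2 ^+ K &
    2 * 4 ^+ K <= 3 * `|\sum_(j < M) e j * 4 ^+ j| ].
Proof.
move=> he; elim: M => [|M IH]; first by left.
have [e0|e0] := eqVneq (e M) 0.
  case: IH => [h|[K]]; [left|right].
    by move=> j; rewrite ltnS leq_eqVlt => /orP[/eqP->//|/h].
  by exists K; rewrite !big_ord_recr/= e0 !mul0r !addr0.
right; exists M; have [h1 h2] := signed_sum_bounds M he.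
rewrite !big_ord_recr/=.
have p2 : 0 < 2 ^+ M :> int by rewrite exprn_gt0.
have p4 : 0 < 4 ^+ M :> int by rewrite exprn_gt0.
have {he e0} : e M = -1 \/ e M = 1 by have := he M; lia.
move: (\sum_(j < M) e j * 2 ^+ j) (\sum_(j < M) e j * 4 ^+ j) (2 ^+ M) (4 ^+ M)
  h1 h2 p2 p4 => a b p q h1 h2 p0 q0.
by move=> [->|->]; split => //; lia.
Qed.

(* The binary expansions of both points start with N zeros. *)
Lemma displacement_small n x y N :
  0 <= x < 2 ^- N -> 0 <= y < 2 ^- N -> displacement n x y -> n != 0 ->
  exists K : nat, [/\ (N <= K)%N, 1 <= `|n.1| <= 2 * 2 ^+ K &
    2 * 4 ^+ K <= 3 * `|n.2| ].
Proof.
have small (z : R) : 0 <= z < 2 ^- N ->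
    forall j, (j <= N)%N -> dyadic_floor j z = 0.
  move=> /andP[z0 zN] j jN; apply: floor_def.
  rewrite mulr_ge0 ?exprn_ge0//= add0r.
  apply: (@le_lt_trans _ _ (2 ^+ N * z)).
    by rewrite ler_wpM2r// ler_weXn2l// ler1n.
  by rewrite mulrC -ltr_pdivlMr ?exp2_gt0// mul1r.
move=> /small x0 /small y0 [L /(_ _ (leqnn L)) [e1 e2]] n0.
rewrite !(x0 0)// !(y0 0)// !add0r in e2.
(* Both integer parts vanish, so the coordinates of [n] are weighted sums of these digit
   differences, of which the first [N] are 0. *)
pose e j := digit j y - digit j x.
have he j : -1 <= e j <= 1.
  by rewrite /e; have [->|->] := digit01 j x; have [->|->] := digit01 j y.
have eN j : (j < N)%N -> e j = 0.
  by move=> jN; rewrite /e /digit !x0 ?y0//; lia.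
have s (w : nat -> int) :
    \sum_(j < L) e j * w j = digit_sum w L y - digit_sum w L x.
  by rewrite /digit_sum -sumrB; apply: eq_bigr => j _; rewrite mulrBl.
have n1 : n.1 = \sum_(j < L) e j * 2 ^+ j.
  by rewrite (s (fun j => 2 ^+ j)) e1; lia.
have n2 : n.2 = \sum_(j < L) e j * 4 ^+ j.
  by rewrite (s (fun j => 4 ^+ j)) e2; lia.
have [h|[K [eK h1 h2]]] := signed_sum_leading L he.
  case/eqP: n0; move: n1 n2; rewrite !big1; last 2 first.
  - by move=> j _; rewrite h ?mul0r.
  - by move=> j _; rewrite h ?mul0r.
  by case: (n) => a b /= -> ->.
exists K; rewrite n1 n2; split=> //.
by rewrite leqNgt; apply: contra eK => /eN ->.
Qed.

End odometer_cocycle.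

(** * Recurrent directions *)

Section no_recurrent_direction.
Variable R : realType.
Local Notation leb := (@completed_lebesgue_measure R).
Local Notation XR := (caratheodory_type (wlength (@idfun R))^*%mu).

Lemma sqrt_sqr_lt (a b e : R) : Num.sqrt (a ^+ 2 + b ^+ 2) < e ->
  `|a| < e /\ `|b| < e.
Proof.
move=> h; split; apply: le_lt_trans h; rewrite -sqrtr_sqr ler_wsqrtr//.
  by rewrite lerDl sqr_ge0.
by rewrite lerDr sqr_ge0.
Qed.

(** The left side is the distance from [(a, b)] to the line of direction [theta]. Bounding the two
    coordinates of the offset separately costs the factor 2. *)
Lemma tunnel_width (eps theta a b : R) : tunnel eps theta (a, b) ->
  `|a * sin theta - b * cos theta| < 2 * eps.
Proof.
move=> [t _] /sqrt_sqr_lt /= [ha hb].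
have -> : a * sin theta - b * cos theta =
    (a - t * cos theta) * sin theta - (b - t * sin theta) * cos theta by ring.
have s1 : `|sin theta| <= 1 by rewrite ler_norml sin_geN1 sin_le1.
have c1 : `|cos theta| <= 1 by rewrite ler_norml cos_geN1 cos_le1.
apply: le_lt_trans (ler_normB _ _) _; rewrite !normrM.
apply: (@le_lt_trans _ _ (`|a - t * cos theta| + `|b - t * sin theta|)).
  by apply: lerD; exact: ler_piMr.
by lra.
Qed.

(** These are the sets that defeat recurrence in a direction. Rationals are removed because
    [odometer] fixes them, so that their returns do not obey the digit count. *)
Lemma irrational_itv_measure (N : nat) :
  measurable (`[0, 2 ^- N[ `\` rational : set XR) /\
  (0 < leb (`[0%R, (2 ^- N)%R[ `\` rational))%E.
Proof.
have mI := completed_itv_measurable `[0 : R, 2 ^- N[.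
have mQ := @rational_measurable R.
split; first exact: measurableD.
have p : 0 < 2 ^- N :> R by rewrite invr_gt0 exprn_gt0.
have := completed_lebesgue_measure_itv `[0 : R, 2 ^- N[.
rewrite /= lte_fin p (measureDI leb mI mQ).
rewrite [X in (_ + X)%E](_ : _ = 0%E) ?adde0.
  by move=> ->; rewrite -EFinB subr0 lte_fin.
apply/eqP; rewrite eq_le measure_ge0 andbT.
rewrite -(completed_lebesgue_measure_rational R).
by apply: le_measure; rewrite ?inE//; exact: measurableI.
Qed.

Lemma odometer_return_not_in_tunnel (theta : R) : exists N : nat,
  forall (n : int * int) (x y : R), 0 <= x < 2 ^- N -> 0 <= y < 2 ^- N ->
    displacement n x y -> n != 0 -> ~ tunnel 2^-1 theta (n.1%:~R, n.2%:~R).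
Proof.
(* With the constant 5, a return has [|n.2 * cos theta| > (10 / 3) * 2 ^+ K], whereas the tunnel of
   radius 1/2 forces it below [2 * 2 ^+ K + 1 <= 3 * 2 ^+ K]. *)
have [N hN] : exists N, cos theta = 0 \/ 5 < 2 ^+ N * `|cos theta|.
  have [c0|c0] := eqVneq (cos theta) 0; first by exists 0%N; left.
  have [N hN] := exp2_unbounded (5 / `|cos theta|).
  by exists N; right; rewrite -ltr_pdivrMr// normr_gt0.
exists N => n x y x0 y0 dxy n0 /tunnel_width; rewrite divff//.
have [K [NK /andP[n1l n1u] n2]] := displacement_small x0 y0 dxy n0.
have {}n1l : 1 <= `|n.1%:~R : R| by rewrite -intr_norm ler1z.
have {}n1u : `|n.1%:~R : R| <= 2 * 2 ^+ K.
  have -> : 2 * 2 ^+ K = (2 * 2 ^+ K)%:~R :> R by rewrite intrM exp2z.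
  by rewrite -intr_norm ler_int.
have {}n2 : 2 * (2 ^+ K * 2 ^+ K) <= 3 * `|n.2%:~R : R|.
  have -> : 2 * (2 ^+ K * 2 ^+ K) = (2 * 4 ^+ K)%:~R :> R.
    by rewrite -exprMn intrM rmorphXn -natrM.
  have -> : 3 * `|n.2%:~R| = (3 * `|n.2|)%:~R :> R by rewrite intrM intr_norm.
  by rewrite ler_int.
(* For the vertical direction the tunnel gives [|n.1| < 1], against [1 <= |n.1|]. *)
case: hN => [c0|hN].
  have : sin theta ^+ 2 == 1 by rewrite -(cos2Dsin2 theta) c0 expr0n add0r.
  rewrite c0 mulr0 subr0 normrM sqrf_eq1 => /orP[] /eqP ->;
    by rewrite ?normrN normr1; lra.
have s1 : `|n.1%:~R * sin theta| <= 2 * 2 ^+ K.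
  rewrite normrM; apply: le_trans n1u; apply: ler_piMr => //.
  by rewrite ler_norml sin_geN1 sin_le1.
have hK : 5 < 2 ^+ K * `|cos theta|.
  by apply: lt_le_trans hN _; rewrite ler_wpM2r// ler_weXn2l// ler1n.
have := ler_normB (n.1%:~R * sin theta)
  (n.1%:~R * sin theta - n.2%:~R * cos theta).
rewrite subKr normrM => h1 h2.
have p : 1 <= 2 ^+ K :> R by apply: exprn_ege1; rewrite ler1n.
move: (2 ^+ K) `|cos theta| `|n.2%:~R| p hK n2 s1 h1 h2 (normr_ge0 (cos theta))
  => q c b; move: `|_ * _| `|_ - _| => u v.
by nra.
Qed.

End no_recurrent_direction.

(** * Ergodicity and recurrence *)

Lemma negligible_countable_bigcup d (T : sigmaRingType d) (R : realFieldType)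
    (mu : {measure set T -> \bar R}) (I : countType) (F : I -> set T) :
  (forall i, mu.-negligible (F i)) -> mu.-negligible (\bigcup_i F i).
Proof.
move=> nF.
apply: (@negligibleS _ _ _ mu (\bigcup_k oapp F set0 (unpickle k))).
  by move=> x [i _ Fix]; exists (pickle i) => //=; rewrite pickleK.
apply: negligible_bigcup => k; case: unpickle => [i|] //=.
exact: negligible_set0.
Qed.

(** * Invariance under dyadic translations *)

Section dyadic_invariance.
Variable R : realType.
Local Notation leb := (@completed_lebesgue_measure R).
Local Notation XR := (caratheodory_type (wlength (@idfun R))^*%mu).

Definition dyadic_invariant (A : set R) :=
  forall k (a : int), shift (a%:~R / 2 ^+ k) @^-1` A = A.

(** Induction on the level [k]: translations by multiples of [2 ^- k] being known, one application
    of the odometer on [ones_piece k] provides the translation by [2 ^- k.+1]. *)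
Lemma odometer_invariant_dyadic (A : set R) :
  (forall x, A (odometer x) <-> A x) ->
  (forall x (a : int), A (x + a%:~R) <-> A x) ->
  dyadic_invariant (A `\` rational).
Proof.
move=> AU AV.
suff H k (a : int) x : ~ rational x -> A (x + a%:~R / 2 ^+ k) <-> A x.
  move=> k a; apply/seteqP; split=> x [Ax irr]; split.
  - apply/(H k a) => // rx; apply: irr.
    exact/rational_shift/rx/rational_dyadic.
  - by move=> rx; apply: irr; apply/rational_shift => //; exact: rational_dyadic.
  - exact/H.
  - by move=> /(rational_shift _ (rational_dyadic _ _ _)).
elim: k a x => [|k IH] a x irr; first by rewrite expr0 divr1.
have irrD y (b : int) l : ~ rational y -> ~ rational (y + b%:~R / 2 ^+ l : R).
  by move=> iy /(rational_shift _ (rational_dyadic _ _ _)).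
have halve (y : R) (b : int) : y + (2 * b)%:~R / 2 ^+ k.+1 = y + b%:~R / 2 ^+ k.
  by rewrite intrM exprS invfM mulrACA divff// mul1r.
have step0 y : ~ rational y -> digit k y = 0 ->
    A (y + 1%:~R / 2 ^+ k.+1) <-> A y.
  (* This [b] brings [y] into [[- 2 ^- k, 0[], where the first [k] digits are 1; digit [k] is still
     0. *)
  move=> iy dy; set b := -1 - dyadic_floor k y.
  have P1 : ones_piece k (y + b%:~R / 2 ^+ k).
    split; first exact: irrD.
    exists 0; rewrite -halve dyadic_floor_shift /b.
    by move: dy; rewrite /digit; lia.
  rewrite -(IH b y iy) -(AU (y + b%:~R / 2 ^+ k)) (odometerE P1).
  (* Modulo multiples of [2 ^- k], the jump is [2 ^- k.+1]. *)
  rewrite (_ : _ + jump R k = (y + 1%:~R / 2 ^+ k.+1) +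
      (b + 1 - 2 ^+ k * (1 + carry k))%:~R / 2 ^+ k).
    by rewrite IH//; exact: irrD.
  rewrite -!halve /jump -!addrA; congr (y + _); rewrite -!mulrDl -!intrD.
  by congr (_%:~R / _); rewrite exprS /b; ring.
have step y : ~ rational y -> A (y + 1%:~R / 2 ^+ k.+1) <-> A y.
  move=> iy; have [dy|dy] := digit01 k y; first exact: step0.
  (* If digit [k] is 1, a half step makes it 0, so [step0] applies there; the two half steps make a
     translation by [2 ^- k]. *)
  rewrite -(step0 (y + 1%:~R / 2 ^+ k.+1)); [|exact: irrD|].
    by rewrite -addrA -mulrDl -intrD (_ : 1 + 1 = 2 * 1)// halve IH.
  have e : dyadic_floor k.+1 (y + 1%:~R / 2 ^+ k.+1) =
      2 ^+ 1 * (dyadic_floor k y + 1) + 0.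
    by rewrite dyadic_floor_shift; move: dy; rewrite /digit; lia.
  rewrite /digit e; move: e; rewrite -{1}addn1 => /dyadic_floor_coarsen -> //.
  by rewrite expr1; lia.
have -> : a = 2 * (a %/ 2)%Z + (a %% 2)%Z by rewrite mulrC -divz_eq.
rewrite intrD mulrDl addrA halve.
have [->|->] : (a %% 2)%Z = 0 \/ (a %% 2)%Z = 1 by lia.
  by rewrite mul0r addr0 IH.
by rewrite step ?IH//; exact: irrD.
Qed.

Lemma dyadic_invariantC (A : set R) :
  dyadic_invariant A -> dyadic_invariant (~` A).
Proof. by move=> hA k a; rewrite -{2}(hA k a). Qed.

Lemma dyadic_invariant_itv_shift (A : set R) k (a : int) (u v : R) :
  dyadic_invariant A ->
  leb (A `&` `]u + a%:~R / 2 ^+ k, v + a%:~R / 2 ^+ k]) = leb (A `&` `]u, v]).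
Proof.
move=> hA; rewrite -[LHS](completed_lebesgue_measure_shift (a%:~R / 2 ^+ k)).
rewrite preimage_setI hA; congr (leb (_ `&` _)).
by apply/seteqP; split=> x /=; rewrite /shift !in_itv/= ltrD2r lerD2r.
Qed.

(** The integer translates of []0, 1]] cover the line, and [A] has the same measure in each. *)
Lemma dyadic_invariant_null (A : set XR) : measurable A -> dyadic_invariant A ->
  leb (A `&` `]0%R, 1%R]) = 0%E -> leb A = 0%E.
Proof.
move=> mA hA A0.
have /negligibleP -> // : leb.-negligible A.
have AE : A `<=` \bigcup_(a in [set: int])
    (A `&` `]0 + a%:~R / 2 ^+ 0, 1 + a%:~R / 2 ^+ 0]).
  move=> x Ax; exists (Num.ceil x - 1) => //; split=> //=.
  rewrite in_itv/= expr0 divr1 add0r intrB.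
  by have := ceil_itv x; rewrite intrB; lra.
apply: (negligibleS AE); apply: negligible_countable_bigcup => a.
apply/negligibleP; last by rewrite -A0; exact: dyadic_invariant_itv_shift.
by apply: measurableI => //; exact: completed_itv_measurable.
Qed.

End dyadic_invariance.

(** * Dyadically invariant sets are null or conull *)

Section dyadic_ergodicity.
Variable R : realType.
Local Notation leb := (@completed_lebesgue_measure R).
Local Notation XR := (caratheodory_type (wlength (@idfun R))^*%mu).
Variable A : set XR.
Hypotheses (mA : measurable A) (hA : dyadic_invariant A).

Let m (u v : R) : \bar R := leb (A `&` `]u, v]).

Let measurable_cell (u v : R) : measurable (A `&` `]u, v] : set XR).
Proof. by apply: measurableI => //; exact: completed_itv_measurable. Qed.

Let m_fin (u v : R) : m u v \is a fin_num.
Proof.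
rewrite ge0_fin_numE; last exact: measure_ge0.
apply: (@le_lt_trans _ _ (leb `]u, v])).
  by apply: le_measure; rewrite ?inE//; exact: completed_itv_measurable.
rewrite completed_lebesgue_measure_itv /=.
by case: ifP => _; rewrite -?EFinB ltry.
Qed.

Let m_split (u v w : R) : u <= v -> v <= w -> (m u w = m u v + m v w)%E.
Proof.
move=> uv vw; rewrite /m -[RHS]measureU//.
  rewrite -setIUr; congr (leb (_ `&` _)); apply/seteqP; split=> x /=.
    rewrite !in_itv/= => /andP[ux xw]; have [xv|vx] := leP x v.
      by left; rewrite ux.
    by right; rewrite xw.
  by rewrite !in_itv/= => -[] /andP[h1 h2]; apply/andP; split; lra.
apply/seteqP; split=> // x [[_ /=]]; rewrite in_itv/= => /andP[_ xv] [_].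
by rewrite /= in_itv/= => /andP[vx _]; lra.
Qed.

Let c := fine (m 0 1).

Let m_cells k (a : int) (n : nat) :
  m (a%:~R / 2 ^+ k) (a%:~R / 2 ^+ k + n%:R / 2 ^+ k) =
  (n%:R * fine (m 0 (2 ^- k)))%:E.
Proof.
elim: n => [|n IH]; first by rewrite !mul0r addr0 /m set_itvoc0 setI0 measure0.
have p : 0 < 2 ^- k :> R by rewrite invr_gt0 exp2_gt0.
rewrite (@m_split _ (a%:~R / 2 ^+ k + n%:R / 2 ^+ k)); last 2 first.
- by rewrite lerDl divr_ge0// ltW// exp2_gt0.
- by rewrite lerD2l ler_pM2r// ler_nat.
have nS : n.+1%:R = n%:R + 1 :> R by rewrite natr1.
rewrite IH nS [(_ + 1) * fine _]mulrDl mul1r EFinD fineK//; congr (_ + _)%E.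
have -> : a%:~R / 2 ^+ k + n%:R / 2 ^+ k = 0 + (a + n)%:~R / 2 ^+ k :> R.
  by rewrite add0r intrD mulrDl.
have -> : a%:~R / 2 ^+ k + (n%:R + 1) / 2 ^+ k =
    2 ^- k + (a + n)%:~R / 2 ^+ k :> R.
  by rewrite intrD !mulrDl mul1r; ring.
exact: dyadic_invariant_itv_shift.
Qed.

Let m_cell k : fine (m 0 (2 ^- k)) = c / 2 ^+ k.
Proof.
have := m_cells k 0 (2 ^ k); rewrite !mul0r add0r natrX divff; last first.
  by rewrite gt_eqF// exp2_gt0.
by rewrite /c => -> /=; rewrite mulrC mulKf// gt_eqF// exp2_gt0.
Qed.

Let c_ge0 : 0 <= c.
Proof. by rewrite fine_ge0//; exact: measure_ge0. Qed.

(** Level [k] dyadic cells, on each of which [A] has measure [c / 2 ^+ k], cover []u, v]] with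
    excess length at most [2 / 2 ^+ k]; the level is chosen so that this excess costs less than
    [e]. *)
Let m_le (u v : R) : u <= v -> (m u v <= (c * (v - u))%:E)%E.
Proof.
move=> uv; rewrite -[m u v]fineK// lee_fin; apply/ler_addgt0Pr => e e0.
have [k hk] := exp2_unbounded (2 * c / e).
set i := dyadic_floor k u; set j := dyadic_floor k v.
have [n jn] : exists n : nat, j + 1 - i = n%:Z.
  exists (absz (j + 1 - i)%R); rewrite gez0_abs//.
  have : i <= j by apply: le_floor; rewrite ler_wpM2l// ltW// exp2_gt0.
  by lia.
have /andP[iu ui] := dyadic_floor_itv k u.
have /andP[jv vj] := dyadic_floor_itv k v.
rewrite -/i -/j in iu ui jv vj.
have p := @exp2_gt0 R k.
have nE : n%:R = j%:~R + 1 - i%:~R :> R.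
  by rewrite -[n%:R]/((n : int)%:~R) -jn intrB intrD.
have : (m u v <= m (i%:~R / 2 ^+ k) (i%:~R / 2 ^+ k + n%:R / 2 ^+ k))%E.
  apply: le_measure; rewrite ?inE//; apply: setIS => x /=; rewrite !in_itv/=.
  rewrite -mulrDl nE => /andP[ux xv]; apply/andP; split.
    by rewrite ltr_pdivrMr//; nra.
  by rewrite ler_pdivlMr//; nra.
rewrite m_cells m_cell -[m u v]fineK// lee_fin => /le_trans; apply.
rewrite -(ler_pM2r p) mulrA mulfVK ?gt_eqF// nE.
move: hk; rewrite ltr_pdivrMr// => hk.
have := c_ge0 => c0.
by nra.
Qed.

Lemma dyadic_invariant_ergodic : leb A = 0%E \/ leb (~` A) = 0%E.
Proof.
have [c0|c0] := eqVneq c 0.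
  left; apply: (dyadic_invariant_null mA hA).
  by rewrite -[leb _](@fineK _ (m 0 1))// -/c c0.
right; have {}c0 : 0 < c by rewrite lt_neqAle eq_sym c0 c_ge0.
apply: (dyadic_invariant_null (measurableC mA) (dyadic_invariantC hA)).
have m1 : (1 <= m 0 1)%E.
  apply: le_ereal_inf_tmp => _ [F [mF AF] <-].
  (* For a cover [F] by half-open intervals, the claim that its total length is at least 1 is
     multiplied by [c > 0]; it then follows from subadditivity and [m_le]. *)
  rewrite -(@lee_pmul2l _ c%:E)// mule1.
  rewrite -nneseriesZl//.
  rewrite [X in (X <= _)%E](_ : _ = m 0 1); last by rewrite /c fineK.
  apply: (@le_trans _ _ (leb (\bigcup_k (A `&` F k)))).
    apply: (le_outer_measure (wlength (@idfun R))^*%mu) => x Ax.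
    by have [k _ Fk] := AF _ Ax; exists k => //; split=> //; case: Ax.
  apply: le_trans (outer_measure_sigma_subadditive (wlength (@idfun R))^*%mu _) _.
  apply: lee_nneseries => // k _.
  have /ocitvP[->|[[u v] /= uv ->]] := mF k.
    by rewrite setI0 outer_measure0 mule_ge0// ?lee_fin ?ltW//.
  by rewrite (wlength_itv_bnd _ _ _ (ltW uv)) -EFinM; apply: m_le; exact: ltW.
have mI := @completed_itv_measurable R `]0%R, 1%R].
have := completed_lebesgue_measure_itv `]0%R : R, 1%R].
rewrite /= lte_fin ltr01 -EFinB subr0 (measureDI leb mI mA) => e.
(* As []0, 1]] has measure 1 and [A] fills at least 1 of it, the rest is null. *)
rewrite setIC -setDE.
have : (leb (`]0%R, 1%R] `\` A) + 1 <= 0 + 1)%E.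
  rewrite add0e -[leRHS]e; apply: leeD2l; rewrite setIC; exact: m1.
rewrite leeD2rE// => h; apply/eqP; rewrite eq_le h; exact: measure_ge0.
Qed.

End dyadic_ergodicity.

Lemma ergodic_nonatomic_recurrent (R : realType) (d : measure_display)
    (X : measurableType d) (mu : {measure set X -> \bar R})
    (T : int * int -> X -> X) :
  measure_preserving_action mu T -> ergodic_action mu T ->
  (forall A, measurable A -> (0 < mu A)%E -> exists B,
    [/\ measurable B, (0 < mu (A `&` B))%E & (0 < mu (A `\` B))%E]) ->
  recurrent_action mu T.
Proof.
move=> [T0 TD mT _] erg na A mA A0.
have TK n : cancel (T n) (T (- n)).
  by move=> x; have := congr1 (@^~ x) (TD (- n) n); rewrite addNr T0.
have TNK n : cancel (T (- n)) (T n).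
  by move=> x; have := congr1 (@^~ x) (TD n (- n)); rewrite subrr T0.
have imT n (E : set X) : T n @` E = T (- n) @^-1` E.
  apply/seteqP; split=> x /=; first by move=> [y Ey <-]; rewrite TK.
  by move=> Ex; exists (T (- n) x) => //; rewrite TNK.
have mimT n (E : set X) : measurable E -> measurable (T n @` E).
  by move=> mE; rewrite imT -[_ @^-1` _]setTI; exact: mT.
have [B [mB B0 B1]] := na A mA A0.
have mAB : measurable (A `&` B) by exact: measurableI.
set W := \bigcup_n (T n @` (A `&` B)).
have mW : measurable W.
  by apply: countable_bigcupT_measurable => [|n]; [exact: countableP|exact: mimT].
have iW n : T n @` W = W.
  rewrite /W image_bigcup; apply/seteqP; split=> x [k _].
    rewrite image_comp -TD => ?; exists (n + k) => //.
  move=> xk; exists (- n + k) => //.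
  by rewrite image_comp -TD addrA subrr add0r.
have ABW : A `&` B `<=` W by move=> x ABx; exists 0 => //; exists x; rewrite ?T0.
have [W0|W0] := erg W mW iW.
  move: B0; rewrite ltNge => /negP[]; rewrite -W0.
  by apply: le_measure; rewrite ?inE.
apply: contrapT => hn.
have null n : n != 0 -> mu (A `&` T n @` A) = 0%E.
  move=> n0; apply/eqP; rewrite -measure_le0 leNgt; apply/negP => h.
  by apply: hn; exists n.
have : mu.-negligible (A `\` B).
  apply: (@negligibleS _ _ _ mu (~` W `|` \bigcup_n
      (if n != 0 then A `&` T n @` A else set0))).
    move=> x [Ax nBx].
    have [[n _ [y [Ay By] yx]]|] := pselect (W x); last by left.
    right; exists n => //; case: eqVneq => [n0|_] /=.
      by apply: nBx; rewrite -yx n0 T0.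
    by split=> //; exists y.
  apply: negligibleU; first by apply/negligibleP => //; exact: measurableC.
  apply: negligible_countable_bigcup => n; case: ifPn => [n0|_].
    apply/negligibleP; last exact: null.
    by apply: measurableI => //; exact: mimT.
  exact: negligible_set0.
by move=> /negligibleP e; move: B1; rewrite e ?ltxx//; exact: measurableD.
Qed.

(** * The required properties of the example *)

Section theorem_ingredients.
Variable R : realType.
Local Notation leb := (@completed_lebesgue_measure R).
Local Notation XR := (caratheodory_type (wlength (@idfun R))^*%mu).

(** Some dyadic cell shorter than the measure of [A] meets [A] in positive measure, and it is too
    short to contain almost all of [A]. *)
Lemma completed_lebesgue_measure_split (A : set XR) : measurable A ->
  (0 < leb A)%E -> exists B : set XR,
    [/\ measurable B, (0 < leb (A `&` B))%E & (0 < leb (A `\` B))%E].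
Proof.
move=> mA A0.
(* A real bound is chosen since [A] may have infinite measure. *)
have [e e0 eA] : exists2 e : R, 0 < e & (e%:E < leb A)%E.
  move: A0; case: (leb A) => [r| |]//; rewrite ?lte_fin => r0.
    by exists (r / 2); rewrite ?lte_fin; lra.
  by exists 1; rewrite ?ltry.
have [k hk] := exp2_unbounded e^-1.
have p := @exp2_gt0 R k.
pose I (a : int) : set XR := `](a%:~R - 1) / 2 ^+ k, a%:~R / 2 ^+ k]%classic.
have mI a : measurable (I a) by exact: completed_itv_measurable.
have [a Ia] : exists a, (0 < leb (A `&` I a))%E.
  apply: contrapT => /forallNP h.
  suff : leb.-negligible A by move=> /negligibleP e'; move: A0; rewrite e' ?ltxx.
  apply: (@negligibleS _ _ _ leb (\bigcup_a (A `&` I a))).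
    move=> x Ax; exists (Num.ceil (2 ^+ k * x)) => //; split=> //=.
    rewrite /I /= in_itv/= ltr_pdivrMr// ler_pdivlMr// [x * _]mulrC.
    by have := ceil_itv (2 ^+ k * x); rewrite intrB; lra.
  apply: negligible_countable_bigcup => a; apply/negligibleP.
    exact: measurableI.
  by apply/eqP; rewrite -measure_le0 leNgt; apply/negP; exact: h.
exists (I a); split=> //; rewrite lt_neqAle measure_ge0 andbT eq_sym.
apply/eqP => d0; move: eA.
rewrite (measureDI leb mA (mI a)) [X in (X + _)%E]d0 add0e ltNge.
move=> /negP; apply; apply: (@le_trans _ _ (leb (I a))).
  by apply: le_measure; rewrite ?inE//; exact: measurableI.
rewrite completed_lebesgue_measure_itv /= lte_fin ltr_pM2r ?invr_gt0//.
rewrite gtrDl oppr_lt0 ltr01 -EFinB lee_fin -mulrBl opprB addrC subrK mul1r.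
by rewrite -[leRHS]invrK lef_pV2 ?posrE ?invr_gt0// ltW.
Qed.

Lemma odometer_action_preserving :
  measure_preserving_action leb (@odometer_action R).
Proof.
split.
- exact: odometer_action0.
- by move=> m n; apply/funext => x; exact: odometer_actionD.
- move=> n _ A mA; rewrite setTI.
  exact: (odometer_action_measurable_preserving n mA).1.
- move=> n A mA; exact: (odometer_action_measurable_preserving n mA).2.
Qed.

Lemma odometer_action_ergodic : ergodic_action leb (@odometer_action R).
Proof.
move=> A mA iA.
have AT n x : A (odometer_action n x) <-> A x.
  have T1 m y : A y -> A (odometer_action m y).
    by move=> Ay; rewrite -(iA m); exists y.
  split=> [/(T1 (- n))|]; last exact: T1.
  by rewrite -odometer_actionD addNr odometer_action0.
have hA : dyadic_invariant (A `\` rational).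
  apply: odometer_invariant_dyadic => [x|x a].
    by rewrite -[X in _ <-> X](AT (1, 0)) /odometer_action /= addr0.
  by rewrite -[X in _ <-> X](AT (0, a)).
have mQ := @rational_measurable R.
have Q0 : leb.-negligible rational.
  by apply/negligibleP => //; exact: completed_lebesgue_measure_rational.
have mAQ : measurable (A `\` rational : set XR) by exact: measurableD.
have [e|e] := dyadic_invariant_ergodic mAQ hA; [left|right].
  apply/negligibleP => //.
  apply: (@negligibleS _ _ _ leb ((A `\` rational) `|` rational)).
    by move=> x Ax; have [|] := pselect (rational x); [right|left].
  by apply: negligibleU => //; exact/negligibleP.
apply/negligibleP; first exact: measurableC.
apply: (@negligibleS _ _ _ leb (~` (A `\` rational))).
  by move=> x nAx [].
by apply/negligibleP => //; exact: measurableC.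
Qed.

Lemma odometer_action_no_direction :
  recurrent_directions leb (@odometer_action R) = set0.
Proof.
apply/seteqP; split=> // theta [_ rec].
have [N hN] := odometer_return_not_in_tunnel theta.
have [mA A0] := irrational_itv_measure R N.
have [|n [n0 ntun pos]] := rec 2^-1 _ _ mA A0; first by rewrite invr_gt0.
set B : set R := `[0, 2 ^- N[ `\` rational in pos.
(* An intersection of positive measure has a point [x], the image of some irrational [z] of [B];
   this return contradicts the choice of [N]. *)
have [[x [[y0 yr] [z [x0 xr] zy]]]|h] :=
    pselect ((B `&` odometer_action n @` B) !=set0).
  have [_ d] := odometer_action_displacement n xr.
  by apply: (hN n z x) ntun => //; rewrite -zy.
by move: pos; move/nonemptyPn: h => ->; rewrite measure0 ltxx.
Qed.

Lemma completed_lebesgue_space : lebesgue_space leb.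
Proof.
split; first exact: completed_lebesgue_measure_is_complete.
exists set0, `]-oo, +oo[; split=> //.
exists setT, setT, id; split.
- by split; [|rewrite setC0|rewrite setC0 setDv; exact: negligible_set0].
- by split=> //; rewrite set_itvNyy// setDv; exact: negligible_set0.
- by split=> // x _; exists x.
- by move=> A _; rewrite image_id.
Qed.

End theorem_ingredients.

Theorem theorem1p4 (R : realType) :
  exists (d : measure_display) (X : measurableType d)
         (mu : {measure set X -> \bar R}) (T : int * int -> X -> X),
    [/\ lebesgue_space mu, sigma_finite setT mu & mu setT = +oo%E] /\
    [/\ measure_preserving_action mu T, recurrent_action mu T,
        ergodic_action mu T & recurrent_directions mu T = set0].
Proof.
exists _, _, (@completed_lebesgue_measure R), (@odometer_action R); split; split.
- exact: completed_lebesgue_space.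
- exact: sigma_finiteT.
- by have := @completed_lebesgue_measure_itv R `]-oo, +oo[; rewrite set_itvNyy.
- exact: odometer_action_preserving.
- apply: ergodic_nonatomic_recurrent.
  + exact: odometer_action_preserving.
  + exact: odometer_action_ergodic.
  + exact: completed_lebesgue_measure_split.
- exact: odometer_action_ergodic.
- exact: odometer_action_no_direction.
Qed.
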